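(* Let $X=\{X(t),\,t\in\mathcal{T}\}$ be a multifractal process with set of scales $\Lambda$, set $\mathcal{S}\subset\mathcal{T}$ and family of scaling factors $\{M(\lambda,t)\}$, and suppose $\overline{q}(X)>0$. If $\Lambda=(0,\infty)$, then for every $\lambda\in\Lambda'$, where $$\Lambda'=\{\lambda\in\Lambda:\ \text{there exists } t\in\mathcal{S}\text{ such that }\lambda t\in\mathcal{S}\},$$ $M(\lambda,t)=m(\lambda)$ is a.s. a constant. In particular, if $\mathcal{S}=\mathcal{T}$, then $X$ is self-similar.
   Context: All processes are real-valued. $\{\cdot\}\overset{d}{=}\{\cdot\}$ denotes equality of finite dimensional distributions. The time set $\mathcal{T}$ is one of $(0,\infty)$, $[0,\infty)$, $(0,T]$, $[0,T]$ with $T>0$. Every process is assumed not identically null: there is $t\in\mathcal{T}$, $t\neq0$, with $P(X(t)\neq0)>0$. A process $X=\{X(t),\,t\in\mathcal{T}\}$ is multifractal (with sets $\Lambda\subset(0,\infty)$, $\mathcal{S}\subset\mathcal{T}$) if for every $\lambda\in\Lambda$ there exists a family of identically distributed positive random variables $\{M(\lambda,t),\,t\in\mathcal{S}\}$, independent of the process $\{X(t)\}$, such that $\{X(\lambda t)\}_{t\in\mathcal{S}}\overset{d}{=}\{M(\lambda,t)X(t)\}_{t\in\mathcal{S}}$. The random field $M=\{M(\lambda,t)\}$ is called the family of scaling factors. When $\mathcal{T}$ is bounded, identities involving $X(\lambda t)$ are understood for those $t$ with $\lambda t\in\mathcal{T}$. $\overline{q}(X)=\sup\{q\ge0:\ \mathbb{E}|X(t)|^q<\infty\text{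 for all }t\in\mathcal{T}\}$. $X$ is self-similar if for every $a>0$ there exists a deterministic $b>0$ such that $\{X(at)\}\overset{d}{=}\{bX(t)\}$ over the whole time set.
   Formalization: When X(0)=0 a.s., the time t=0 is removed from S in forming Λ', since the claim fails there: for X(t)=t, S={0}, the factor M(λ,0) may be any nonconstant positive variable. The self-similarity claim for S=T is unchanged. *)

(* Defs.v *)
From HB Require Import structures.
From mathcomp Require Import all_boot all_order all_algebra.
From mathcomp Require Import all_classical all_reals all_analysis.

Set Implicit Arguments.
Unset Strict Implicit.
Unset Printing Implicit Defensive.

Import Order.TTheory GRing.Theory Num.Theory.

Local Open Scope classical_set_scope.
Local Open Scope ring_scope.

(* A process with time set T is a family [X : R -> {RV P >-> R}] of which only
   the variables [X t] with [t] in T matter: every definition below restricts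
   the times it looks at, so the values of [X] off T play no role. *)

Definition is_time_set (R : realType) (T : set R) : Prop :=
  [\/ T = `]0, +oo[%classic, T = `[0, +oo[%classic,
      exists2 c : R, 0 < c & T = `]0, c]%classic |
      exists2 c : R, 0 < c & T = `[0, c]%classic ].

Section Processes.
Context (d : measure_display) (Omega : measurableType d) (R : realType).
Context (P : probability Omega R).
Implicit Types (T D S Lam : set R) (X : R -> {RV P >-> R}).

(* [n.-tuple R] carries the product Borel sigma-algebra. *)
Definition fdd_eq D (Y Z : R -> Omega -> R) : Prop :=
  forall (n : nat) (t : 'I_n -> R), (forall i, D (t i)) ->
  forall B : set (n.-tuple R), measurable B ->
    P ((fun w => [tuple Y (t i) w | i < n]) @^-1` B) =
    P ((fun w => [tuple Z (t i) w | i < n]) @^-1` B).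

(* Laws are compared on measurable sets only, since a measure is a function on
   all sets and is unspecified on nonmeasurable ones. *)
Definition identically_distributed D X : Prop :=
  forall s t, D s -> D t -> forall B : set R, measurable B ->
    distribution P (X s) B = distribution P (X t) B.

Definition sigma_family D X : set (set Omega) :=
  <<s \bigcup_(t in D) preimage_set_system setT (X t) measurable >>.

Definition independent_families D X D' X' : Prop :=
  forall A B, sigma_family D X A -> sigma_family D' X' B ->
    P (A `&` B) = (P A * P B)%E.

Definition not_identically_null T X : Prop :=
  exists t, [/\ T t, t != 0 & (0 < P [set w | (X t w != 0)%R])%E].

(* The times in S at which both sides of an identity between [X (lam * t)] and
   a process indexed by [t] make sense; this is S when T is unbounded. *)
Definition rescaled_times T S (lam : R) : set R :=
  [set t | S t /\ T (lam * t)].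

Definition multifractal T X Lam S (M : R -> R -> {RV P >-> R}) : Prop :=
  [/\ Lam `<=` `]0, +oo[%classic, S `<=` T &
      forall lam, Lam lam ->
      [/\ identically_distributed S (M lam),
          forall t, S t -> {ae P, forall w, 0 < M lam t w},
          independent_families S (M lam) T X &
          fdd_eq (rescaled_times T S lam)
            (fun t => X (lam * t)) (fun t w => M lam t w * X t w)]].

Definition qbar T X : \bar R :=
  ereal_sup [set q%:E | q in [set q : R | 0 <= q /\
    forall t, T t -> ('E_P[fun w => (`|X t w| `^ q)%R] < +oo)%E]].

Definition self_similar T X : Prop :=
  forall a : R, 0 < a -> exists2 b : R, 0 < b &
    fdd_eq (rescaled_times T T a)
      (fun t => X (a * t)) (fun t w => b * X t w).

(* {0} if X(0) = 0 almost surely, and the empty set otherwise. *)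
Definition null_origin X : set R :=
  [set t | t = 0 /\ {ae P, forall w, X t w = 0}].

End Processes.

Definition inner_scales (R : realType) (Lam S : set R) : set R :=
  [set lam | Lam lam /\ exists2 t, S t & S (lam * t)].

(* Main.v *)
Require Import Defs.
From HB Require Import structures.
From mathcomp Require Import all_boot all_order all_algebra.
From mathcomp Require Import all_classical all_reals all_analysis.
From mathcomp Require Import measurable_realfun.

Set Implicit Arguments.
Unset Strict Implicit.
Unset Printing Implicit Defensive.

Import Order.TTheory GRing.Theory Num.Theory.

Local Open Scope classical_set_scope.
Local Open Scope ring_scope.

(** For [lam] with [t] and [lam * t] in [S], the process can be rescaled from [t]
to [lam * t] and back, so the law of [X t] is unchanged under multiplication by
two independent positive factors distributed as [M := M lam t] and
[M' := M lam^-1 (lam * t)]. Taking absolute moments of any order [r] that is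
finite and nonzero for [X t] gives [E M^r * E M'^r = 1]
([absmoment_rescale], [mule_cycle_reciprocal]). Take [r = q] and [r = q / 2],
where [q > 0] is an order at which all moments of the process are finite. By
Jensen's inequality,
[[
  1 = (E M^(q/2))^2 * (E M'^(q/2))^2 <= E M^q * E M'^q = 1,
]]
so both Jensen inequalities are equalities, [M^(q/2)] has zero variance, and [M]
is almost surely constant ([ae_cst_of_reciprocal_moments]).

Dividing by the moments of [X t] requires [X t] not to be almost surely zero.
At a time [t != 0] this holds because every positive number is a scale: if
[X t] vanished almost surely, so would [X t0] for every other nonzero time [t0],
being distributed as [M (t0 / t) t * X t] ([multifractal_nonnull]).

When [S = T], every [a > 0] admits a nonzero [t] with [t] and [a * t] in [T]
([time_set_rescale]); the factors at scale [a] are then constant, and replacing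
them by that constant leaves the finite dimensional distributions unchanged
([fdd_eq_ae]), which is self-similarity. *)

(** * Products of independent variables and variance *)

Section RandomVariables.
Context (d : measure_display) (Omega : measurableType d) (R : realType).
Context (P : probability Omega R).
Implicit Types (X Y Z : {RV P >-> R}) (f g : R -> R).

Lemma ge0_expectation_distribution Y f : measurable_fun setT f ->
  (forall x, 0 <= f x) ->
  'E_P[f \o Y]%E = (\int[distribution P Y]_y (f y)%:E)%E.
Proof.
move=> mf f0; rewrite unlock ge0_integral_distribution//.
exact/measurable_EFinP.
Qed.

Lemma eq_law_expectation Y Z f : measurable_fun setT f ->
  (forall x, 0 <= f x) ->
  (forall B, measurable B -> P (Y @^-1` B) = P (Z @^-1` B)) ->
  ('E_P[f \o Y] = 'E_P[f \o Z])%E.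
Proof.
move=> mf f0 YZ; rewrite !ge0_expectation_distribution//.
by apply: eq_measure_integral => B mB _; exact: YZ.
Qed.

(** The identity on rectangles determines the joint law of [(Y, Z)]: it is the
product of the two marginals, and Tonelli's theorem then separates the
integral. *)
Lemma expectation_indepM Y Z f g :
  measurable_fun setT f -> measurable_fun setT g ->
  (forall x, 0 <= f x) -> (forall x, 0 <= g x) ->
  (forall A B, measurable A -> measurable B ->
     P (Y @^-1` A `&` Z @^-1` B) = (P (Y @^-1` A) * P (Z @^-1` B))%E) ->
  ('E_P[(f \o Y) \* (g \o Z)] = 'E_P[f \o Y] * 'E_P[g \o Z])%E.
Proof.
move=> mf mg f0 g0 YZ.
have mW : measurable_fun setT (fun w => (Y w, Z w)).
  by apply/measurable_fun_pairP; split.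
pose W : {RV P >-> (R * R)%type} := HB.pack (fun w => (Y w, Z w))
  (isMeasurableFun.Build _ _ _ _ _ mW).
pose h := fun x : R * R => (f x.1 * g x.2)%:E.
have mh : measurable_fun setT h.
  by apply/measurable_EFinP; apply: measurable_funM;
    apply: measurableT_comp.
have h0 x : (0 <= h x)%E by rewrite lee_fin mulr_ge0.
have Eg_ge0 : (0 <= \int[distribution P Z]_y (g y)%:E)%E.
  by apply: integral_ge0 => y _; rewrite lee_fin.
transitivity (\int[distribution P W]_x h x)%E.
  by rewrite ge0_integral_distribution// unlock.
transitivity (\int[(distribution P Y \x distribution P Z)%E]_x h x)%E.
  apply: eq_measure_integral => A mA _; apply/esym.
  by apply: product_measure_unique => // B C mB mC; exact: YZ.
rewrite fubini_tonelli1// /fubini_F/= !ge0_expectation_distribution//.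
transitivity (\int[distribution P Y]_x
    ((f x)%:E * \int[distribution P Z]_y (g y)%:E))%E.
  apply: eq_integral => x _; under eq_integral do rewrite /h/= EFinM.
  rewrite ge0_integralZl ?lee_fin//; first exact/measurable_EFinP.
  by move=> y _; rewrite lee_fin.
rewrite ge0_integralZr//; first exact/measurable_EFinP.
by move=> y _; rewrite lee_fin.
Qed.

Lemma sqr_integrable_Lfun2 (A : Omega -> R) : measurable_fun setT A ->
  ('E_P[A ^+ 2] < +oo)%E -> A \in Lfun P 2%:E.
Proof.
move=> mA A2.
rewrite inE; apply/andP; split; rewrite !inE/=; first exact: mA.
rewrite /finite_norm unlock /Lnorm poweR_lty//.
move: A2; rewrite unlock; congr (_ < _)%E; apply: eq_integral => w _.
by rewrite /= powR_mulrn// real_normK// num_real.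
Qed.

Lemma le_sqr_expectation (A : Omega -> R) : measurable_fun setT A ->
  ('E_P[A ^+ 2] < +oo)%E -> ('E_P[A] ^+ 2 <= 'E_P[A ^+ 2])%E.
Proof.
move=> mA A2; have L2 := sqr_integrable_Lfun2 mA A2.
have L1 : A \in Lfun P 1 by rewrite Lfun_subset12// fin_num_measure.
have := variance_ge0 P A; rewrite varianceE// sube_ge0//.
by rewrite fin_numX// expectation_fin_num.
Qed.

(** Equality in Jensen's inequality for the square means that the variance, the
integral of a nonnegative function, is zero. *)
Lemma ae_cst_of_sqr_expectation (A : Omega -> R) : measurable_fun setT A ->
  ('E_P[A ^+ 2] < +oo)%E -> ('E_P[A] ^+ 2 = 'E_P[A ^+ 2])%E ->
  {ae P, forall w, A w = fine 'E_P[A]}.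
Proof.
move=> mA A2 EA; have L2 := sqr_integrable_Lfun2 mA A2.
have L1 : A \in Lfun P 1 by rewrite Lfun_subset12// fin_num_measure.
have V0 : 'V_P[A] = 0%E.
  by rewrite varianceE// -EA subee// fin_numX// expectation_fin_num.
move: V0; rewrite /variance covariance.unlock.
(* Naming the mean before unfolding keeps the outer expectation as the only
   one to be unfolded. *)
set c := fine _; rewrite expectation.unlock => V0.
have mAc : measurable_fun setT (EFin \o ((A \- cst c) * (A \- cst c))).
  apply/measurable_EFinP; apply: measurable_funM;
  by apply: measurable_funB => //; exact: measurable_cst.
have /ae_eq_integral_abs : (\int[P]_w
    `|(EFin \o ((A \- cst c) * (A \- cst c))%R) w| = 0)%E.
  rewrite -V0; apply: eq_integral => w _ /=.
  by rewrite ger0_norm// -expr2 sqr_ge0.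
move=> /(_ measurableT mAc); apply: filterS => w /= /(_ I)[].
by move=> /eqP; rewrite mulf_eq0 orbb subr_eq0 => /eqP.
Qed.

End RandomVariables.

(** * Variables with reciprocal moments *)

Section ConstantFactors.
Context (d : measure_display) (Omega : measurableType d) (R : realType).
Context (P : probability Omega R).
Implicit Types (X Y Z : {RV P >-> R}).

(** Here [u] stands for a moment of a variable that is multiplied by two
independent factors with moments [a] and [b] and recovers its law. Cancelling
[u] already takes place in the extended reals, and [b * a = 1] excludes infinite
values: the moments of the factors turn out to be finite. *)
Lemma mule_cycle_reciprocal (a b u : \bar R) : (0 <= a)%E -> (0 <= b)%E ->
  (0 < u)%E -> u \is a fin_num -> u = (b * (a * u))%E ->
  [/\ a \is a fin_num, b \is a fin_num & fine a * fine b = 1].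
Proof.
move=> a0 b0 u0 uf E.
have u0' : u != 0%E by rewrite gt_eqF.
have ba1 : (b * a = 1)%E.
  have /(congr1 (fun x => x * u^-1)%E) := E.
  by rewrite divee// -muleA -muleA divee// mule1 => <-.
have bne0 : (b != 0)%E.
  by apply: contra_eq_neq ba1 => ->; rewrite mul0e eq_sym onee_neq0.
have ane0 : (a != 0)%E.
  by apply: contra_eq_neq ba1 => ->; rewrite mule0 eq_sym onee_neq0.
have b_gt0 : (0 < b)%E by rewrite lt0e bne0.
have a_gt0 : (0 < a)%E by rewrite lt0e ane0.
have af : a \is a fin_num.
  by case: a a_gt0 ba1 {E a0 ane0} => //; rewrite gt0_muley.
have bf : b \is a fin_num.
  by case: b b_gt0 ba1 {E b0 bne0} => //; rewrite gt0_mulye.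
by split=> //; rewrite -fineM// muleC ba1.
Qed.

(** Jensen's inequality bounds [(E A)^2 * (E B)^2 = 1] by
[E A^2 * E B^2 = 1] factor by factor, so neither bound can be strict. *)
Lemma ae_cst_of_reciprocal_moments (A B : Omega -> R) :
  measurable_fun setT A -> measurable_fun setT B ->
  ('E_P[A ^+ 2] < +oo)%E -> ('E_P[B ^+ 2] < +oo)%E ->
  fine ('E_P[A])%E * fine ('E_P[B])%E = 1 ->
  fine ('E_P[A ^+ 2])%E * fine ('E_P[B ^+ 2])%E = 1 ->
  {ae P, forall w, A w = fine ('E_P[A])%E}.
Proof.
move=> mA mB A2 B2 e1 e2.
have fin2 (C : Omega -> R) : ('E_P[C ^+ 2] < +oo)%E ->
    ('E_P[C ^+ 2] \is a fin_num)%E.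
  by move=> C2; rewrite ge0_fin_numE// expectation_ge0// => w; rewrite sqr_ge0.
have fin1 (C : Omega -> R) : measurable_fun setT C ->
    ('E_P[C ^+ 2] < +oo)%E -> ('E_P[C] \is a fin_num)%E.
  move=> mC C2; rewrite expectation_fin_num// Lfun_subset12 ?fin_num_measure//.
  exact: sqr_integrable_Lfun2.
have hA := le_sqr_expectation mA A2; have hB := le_sqr_expectation mB B2.
apply: (ae_cst_of_sqr_expectation mA A2) => //.
move: (fin1 _ mA A2) (fin1 _ mB B2) (fin2 _ A2) (fin2 _ B2) e1 e2 hA hB.
move: ('E_P[A])%E ('E_P[B])%E ('E_P[A ^+ 2])%E ('E_P[B ^+ 2])%E.
move=> [a1||]// [b1||]// [a2||]// [b2||]// _ _ _ _.
rewrite -!EFin_expe !lee_fin => /= e1 e2 ha hb; congr (_%:E).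
have a2b : a1 ^+ 2 * b1 ^+ 2 = 1 by rewrite -exprMn e1 expr1n.
have b1sq : 0 < b1 ^+ 2.
  by rewrite lt0r sqr_ge0 andbT; apply: contra_eq_neq a2b => ->;
    rewrite mulr0 eq_sym oner_neq0.
have a2_ge0 : 0 <= a2 by rewrite (le_trans (sqr_ge0 a1)).
apply/eqP; rewrite eq_le ha /= -(ler_pM2r b1sq) a2b -e2.
exact: ler_wpM2l.
Qed.

(** * Absolute moments *)

Definition absmoment (p : R) (Y : Omega -> R) : \bar R :=
  ('E_P[fun w => (`|Y w| `^ p)%R])%E.

Lemma measurable_abspow p : measurable_fun setT (fun x : R => `|x| `^ p).
Proof. exact: (measurableT_comp (measurable_powR p)). Qed.

Lemma absmoment_ge0 p Y : (0 <= absmoment p Y)%E.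
Proof. by apply: expectation_ge0 => w; exact: powR_ge0. Qed.

(** The hypothesis [0 < p] excludes the convention [0 `^ 0 = 1], under which the
moment of order [0] is [1] also for the zero variable. *)
Lemma absmoment_gt0 p Y : 0 < p -> ~ {ae P, forall w, Y w = 0} ->
  (0 < absmoment p Y)%E.
Proof.
move=> p0 Y0; rewrite lt0e absmoment_ge0 andbT; apply/eqP => m0; apply: Y0.
have mY : measurable_fun setT (EFin \o (fun w => `|Y w| `^ p)).
  by apply/measurable_EFinP; exact: (measurableT_comp (measurable_abspow p)).
have /ae_eq_integral_abs : (\int[P]_w
    `|(EFin \o (fun w => (`|Y w| `^ p)%R)) w| = 0)%E.
  rewrite -m0 /absmoment unlock; apply: eq_integral => w _ /=.
  by rewrite ger0_norm// powR_ge0.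
move=> /(_ measurableT mY); apply: filterS => w /= /(_ I)[].
by move=> /eqP; rewrite powR_eq0 normr_eq0 => /andP[/eqP].
Qed.

Lemma absmoment_indepM p Y Z :
  (forall A B, measurable A -> measurable B ->
     P (Y @^-1` A `&` Z @^-1` B) = (P (Y @^-1` A) * P (Z @^-1` B))%E) ->
  absmoment p (Y \* Z) = (absmoment p Y * absmoment p Z)%E.
Proof.
move=> YZ; rewrite /absmoment.
rewrite -(expectation_indepM (measurable_abspow p) (measurable_abspow p))//;
  try by move=> x; exact: powR_ge0.
by congr expectation; apply/funext => w /=; rewrite normrM powRM.
Qed.

Lemma absmoment_sqr p (Y : Omega -> R) :
  ('E_P[((fun w => `|Y w| `^ p) ^+ 2)%R])%E = absmoment (p * 2) Y.
Proof.
rewrite /absmoment; congr expectation; apply/funext => w /=.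
by rewrite powRrM powR_mulrn ?powR_ge0.
Qed.


(** * Laws, finite dimensional distributions and null sets *)

Lemma ae_eq_measure (A B : set Omega) : measurable A -> measurable B ->
  {ae P, forall w, A w <-> B w} -> P A = P B.
Proof.
move=> mA mB AB; rewrite -(setIT A) -(setIT B) -!integral_indic//.
apply: ae_eq_integral => //.
- exact/measurable_EFinP/measurable_indic.
- exact/measurable_EFinP/measurable_indic.
apply: filterS AB => w AB _; rewrite !indicE; congr (_%:R%:E).
by congr (nat_of_bool _); apply/idP/idP; rewrite !inE => /AB.
Qed.

(** A finite dimensional distribution involves finitely many times, so the
exceptional null sets at these times have a null union, whatever the size of
[D]. *)
Lemma fdd_eq_ae (D : set R) (Y Z Z' : R -> Omega -> R) :
  (forall t, D t -> measurable_fun setT (Z t)) ->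
  (forall t, D t -> measurable_fun setT (Z' t)) ->
  (forall t, D t -> {ae P, forall w, Z t w = Z' t w}) ->
  fdd_eq P D Y Z -> fdd_eq P D Y Z'.
Proof.
move=> mZ mZ' ZZ' YZ n t Dt B mB; rewrite YZ//.
have mtuple (V : R -> Omega -> R) :
    (forall s, D s -> measurable_fun setT (V s)) ->
    measurable ((fun w => [tuple V (t i) w | i < n]) @^-1` B).
  move=> mV; rewrite -[X in measurable X]setTI.
  suff : measurable_fun setT (fun w => [tuple V (t i) w | i < n]) by exact.
  apply/measurable_fun_tnthP => i.
  rewrite (_ : _ \o _ = V (t i)); first exact: mV.
  by apply/funext => w /=; rewrite tnth_mktuple.
apply: ae_eq_measure; [exact: mtuple|exact: mtuple|].
have : {ae P, forall w, forall i, Z (t i) w = Z' (t i) w}.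
  by apply: filter_forall => i; exact: ZZ'.
apply: filterS => w ZZ'w /=.
by rewrite (_ : [tuple _ | i < n] = [tuple Z' (t i) w | i < n])//;
  apply: eq_from_tnth => i; rewrite !tnth_mktuple.
Qed.

(** Sets of [1]-tuples are identified with subsets of the line through their only
coordinate. *)
Lemma fdd_eq_marginal (D : set R) (Y Z : R -> Omega -> R) t :
  fdd_eq P D Y Z -> D t ->
  forall B, measurable B -> P (Y t @^-1` B) = P (Z t @^-1` B).
Proof.
move=> YZ Dt B mB.
have mB' : measurable ((@tnth 1 R ^~ ord0) @^-1` B).
  by rewrite -[X in measurable X]setTI; exact: measurable_tnth.
have := YZ 1 (fun=> t) (fun=> Dt) _ mB'.
have E (V : R -> Omega -> R) : (fun w => [tuple V t w | i < 1]) @^-1`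
    ((@tnth 1 R ^~ ord0) @^-1` B) = V t @^-1` B.
  by apply/seteqP; split => w /=; rewrite tnth_mktuple.
by rewrite !E.
Qed.

Lemma independent_families_pair (D D' : set R) (Y Z : R -> {RV P >-> R}) s t :
  independent_families D Y D' Z -> D s -> D' t ->
  forall A B, measurable A -> measurable B ->
    P (Y s @^-1` A `&` Z t @^-1` B) = (P (Y s @^-1` A) * P (Z t @^-1` B))%E.
Proof.
move=> YZ Ds D't A B mA mB; apply: YZ; apply: sub_gen_smallest.
- by exists s => //; exists A => //; rewrite setTI.
- by exists t => //; exists B => //; rewrite setTI.
Qed.

(** Being almost surely [c] is a property of the law: the complement of [{c}] has
measure zero. *)
Lemma ae_cst_law Y Z c :
  (forall B, measurable B -> distribution P Y B = distribution P Z B) ->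
  {ae P, forall w, Y w = c} -> {ae P, forall w, Z w = c}.
Proof.
move=> YZ Yc.
have ms (W : {RV P >-> R}) : measurable (W @^-1` (~` [set c])).
  by rewrite -[X in measurable X]setTI; apply: measurable_funPT => //;
    apply: measurableC.
apply/(negligibleP _ (ms Z)).
rewrite -[LHS](YZ (~` [set c])); last exact: measurableC.
exact/(negligibleP _ (ms Y)).
Qed.

End ConstantFactors.

(** * Time sets *)

Section TimeSets.
Context (R : realType).
Implicit Types (T : set R) (t a : R).

Lemma time_set_ge0 T t : is_time_set T -> T t -> 0 <= t.
Proof.
by case=> [->|->|[c c0 ->]|[c c0 ->]]; rewrite /= in_itv/= => /andP[]// /ltW.
Qed.

(** A time set contains all sufficiently small positive numbers, hence every scale
is an inner scale when the factors are indexed by the whole time set. *)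
Lemma time_set_rescale T a : is_time_set T -> 0 < a ->
  exists t, [/\ t != 0, T t & T (a * t)].
Proof.
move=> hT a0.
have unbounded : `]0, +oo[%classic `<=` T ->
    exists t, [/\ t != 0, T t & T (a * t)].
  move=> sT; exists 1; split; first exact: oner_neq0.
    by apply: sT; rewrite /= in_itv/= ltr01.
  by apply: sT; rewrite /= in_itv/= mulr1 a0.
have bounded c : 0 < c -> `]0, c]%classic `<=` T ->
    exists t, [/\ t != 0, T t & T (a * t)].
  (* Both [t] and [a * t] must stay below [c]: dividing by [1 + a], which exceeds
     [1] and [a], achieves both at once. *)
  move=> c0 sT; exists (c / (1 + a)).
  have a1 : 0 < 1 + a by rewrite addr_gt0.
  have ca : 0 < c / (1 + a) by rewrite divr_gt0.
  split; first by rewrite gt_eqF.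
  - apply: sT; rewrite /= in_itv/= ca/= ler_pdivrMr// ler_pMr//.
    by rewrite lerDl ltW.
  - apply: sT; rewrite /= in_itv/= mulr_gt0//= mulrA ler_pdivrMr// mulrC.
    by rewrite ler_wpM2l ?ltW// ltrDr.
case: hT => [TE|TE|[c c0 TE]|[c c0 TE]].
- by apply: unbounded; rewrite TE.
- by apply: unbounded; rewrite TE => x; rewrite /= !in_itv/= !andbT => /ltW.
- by apply: (bounded c) => //; rewrite TE.
- apply: (bounded c) => //; rewrite TE => x.
  by rewrite /= !in_itv/= => /andP[/ltW -> ->].
Qed.

End TimeSets.

(** * Scaling factors of a multifractal process *)

Section Multifractal.
Context (d : measure_display) (Omega : measurableType d) (R : realType).
Context (P : probability Omega R) (T S : set R) (X : R -> {RV P >-> R}).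
Context (M : R -> R -> {RV P >-> R}).
Context (hM : multifractal T X `]0, +oo[%classic S M).

Lemma multifractal_law lam t : 0 < lam -> S t -> T (lam * t) ->
  forall B, measurable B ->
    P (X (lam * t) @^-1` B) = P ((M lam t \* X t) @^-1` B).
Proof.
case: hM => _ _ hM' l0 St Tlt B mB.
have [|_ _ _ fdd] := hM' lam; first by rewrite /= in_itv/= l0.
exact: (fdd_eq_marginal fdd).
Qed.

Lemma absmoment_rescale p lam t : 0 < lam -> S t -> T (lam * t) ->
  absmoment P p (X (lam * t)) =
    (absmoment P p (M lam t) * absmoment P p (X t))%E.
Proof.
move=> l0 St Tlt; rewrite -absmoment_indepM.
  apply: (@eq_law_expectation _ _ _ _ _ (M lam t \* X t)
    _ (measurable_abspow p)) => [x|]; first exact: powR_ge0.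
  exact: multifractal_law.
case: hM => _ sST hM'.
have [|_ _ ind _] := hM' lam; first by rewrite /= in_itv/= l0.
by apply: (independent_families_pair ind) => //; exact: sST.
Qed.

(** Since every positive number is a scale, each nonzero time of [S] is rescaled
to any time [t0] at which the process is not null, and multiplying a null
variable by a factor cannot produce [X t0]. The remaining time [0] is covered by
the very definition of [null_origin]. *)
Lemma multifractal_nonnull t : is_time_set T -> not_identically_null T X ->
  S t -> ~ null_origin X t -> ~ {ae P, forall w, X t w = 0}.
Proof.
move=> hT [t0 [Tt0 t0_neq0 Xt0]] St t_nonnull Xt.
have sST : S `<=` T by case: hM.
have t_neq0 : t != 0.
  by apply/eqP => tE; apply: t_nonnull.
have t_gt0 : 0 < t by rewrite lt0r t_neq0 (time_set_ge0 hT)//; exact: sST.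
have t0_gt0 : 0 < t0 by rewrite lt0r t0_neq0 (time_set_ge0 hT).
have lt : t0 / t * t = t0 by rewrite divfK.
have mN : measurable (~` [set 0 : R]) by exact: measurableC.
have mW (W : {RV P >-> R}) : measurable (W @^-1` (~` [set 0])).
  by rewrite -[X in measurable X]setTI; exact: measurable_funPT.
have := @multifractal_law (t0 / t) t.
rewrite lt divr_gt0// => /(_ isT St Tt0 _ mN) E.
move: Xt0; rewrite (_ : [set w | _] = X t0 @^-1` (~` [set 0])); last first.
  by apply/seteqP; split => w /= /eqP.
rewrite E.
suff -> : P ((M (t0 / t) t \* X t) @^-1` (~` [set 0])) = 0%E by rewrite ltxx.
apply/(negligibleP _ (mW (M (t0 / t) t \* X t))).
by apply: filterS Xt => w /= ->; rewrite mulr0.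
Qed.

(** Rescaling from [t] to [lam * t] and back makes the moments of the two factors
reciprocal to each other, at order [q] and at order [q / 2] alike. This forces
the factor to be constant at the time [t], hence at all times of [S], where it
has the same law. *)
Lemma scaling_factor_ae_cst lam q t : 0 < q ->
  (forall s, T s -> (absmoment P q (X s) < +oo)%E) ->
  0 < lam -> S t -> S (lam * t) -> ~ {ae P, forall w, X t w = 0} ->
  exists c, forall s, S s -> {ae P, forall w, M lam s w = c}.
Proof.
move=> q0 Xq l0 St Slt Xt.
have [_ sST hM'] := hM.
pose p := q / 2; have p0 : 0 < p by rewrite divr_gt0.
have pq : p * 2 = q by rewrite divfK.
have lK : lam^-1 * (lam * t) = t by rewrite mulKf// gt_eqF.
have [|idl posl _ _] := hM' lam; first by rewrite /= in_itv/= l0.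
set A := fun w => `|M lam t w| `^ p.
set B := fun w => `|M lam^-1 (lam * t) w| `^ p.
have mabs (W : {RV P >-> R}) : measurable_fun setT (fun w => `|W w| `^ p).
  exact: (measurableT_comp (measurable_abspow p)).
have Xfin2 : absmoment P q (X t) \is a fin_num.
  by rewrite ge0_fin_numE ?absmoment_ge0//; apply: Xq; exact: sST.
(* Finiteness at order [q / 2] follows from order [q], as [P] is finite. *)
have Xfin1 : absmoment P p (X t) \is a fin_num.
  rewrite expectation_fin_num// Lfun_subset12 ?fin_num_measure//.
  apply: sqr_integrable_Lfun2 => //.
  by rewrite absmoment_sqr pq Xq//; exact: sST.
have cycle r : 0 < r -> absmoment P r (X t) \is a fin_num ->
    [/\ absmoment P r (M lam t) \is a fin_num,
        absmoment P r (M lam^-1 (lam * t)) \is a fin_num &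
        fine (absmoment P r (M lam t)) *
        fine (absmoment P r (M lam^-1 (lam * t))) = 1].
  move=> r0 Xr; apply: (@mule_cycle_reciprocal _ _ _ (absmoment P r (X t))).
  - exact: absmoment_ge0.
  - exact: absmoment_ge0.
  - exact: absmoment_gt0.
  - by [].
  - rewrite -absmoment_rescale//; last exact: sST.
    by rewrite -absmoment_rescale ?invr_gt0// lK//; exact: sST.
have [_ _ AB1] := cycle p p0 Xfin1.
have [A2 B2 AB2] := cycle q q0 Xfin2.
have Acst : {ae P, forall w, A w = fine ('E_P[A])%E}.
  apply: (@ae_cst_of_reciprocal_moments _ _ _ _ A B) => //.
  - exact: mabs.
  - exact: mabs.
  - by rewrite absmoment_sqr pq -ge0_fin_numE// absmoment_ge0.
  - by rewrite absmoment_sqr pq -ge0_fin_numE// absmoment_ge0.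
  - by rewrite !absmoment_sqr pq.
exists (fine ('E_P[A])%E `^ p^-1) => s Ss.
apply: (@ae_cst_law _ _ _ _ (M lam t)) => [B' mB'|]; first exact: idl.
have := posl t St; apply: filterS2 Acst => w Aw Mw.
(* Since [M lam t] is almost surely positive, it is recovered from the power
   [A] of its absolute value. *)
by rewrite -Aw /A -powRrM divff ?gt_eqF// powRr1// gtr0_norm.
Qed.

End Multifractal.

(** * Multifractal processes with all positive scales *)

(* The origin is discarded from S when X(0) = 0 almost surely: the pair
   (0, lam * 0) carries no information there, and M(lam, 0) is unconstrained.
   For instance, with X(t) = t and S = {0} every positive M is admissible. *)
Theorem proposition2p2 (d : measure_display) (Omega : measurableType d)
    (R : realType) (P : probability Omega R)
    (T : set R) (X : R -> {RV P >-> R})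
    (Lam S : set R) (M : R -> R -> {RV P >-> R})
    (hT : is_time_set T)
    (hX : not_identically_null T X)
    (hM : multifractal T X Lam S M)
    (hq : (0 < qbar T X)%E)
    (hLam : Lam = `]0, +oo[%classic) :
  (exists m : R -> R,
     forall lam, inner_scales Lam (S `\` null_origin X) lam ->
     forall t, S t -> {ae P, forall w, M lam t w = m lam}) /\
  (S = T -> self_similar T X).
Proof.
have [q q0 Xq] : exists2 q : R, 0 < q &
    forall s, T s -> (absmoment P q (X s) < +oo)%E.
  have /ereal_sup_gt[_ [q [_ Xq] <-]] := hq.
  by rewrite lte_fin => q0; exists q.
rewrite {Lam}hLam in hM *.
have factor_cst lam : exists c,
    inner_scales `]0, +oo[%classic (S `\` null_origin X) lam ->
    forall s, S s -> {ae P, forall w, M lam s w = c}.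
  have [|not_inner] :=
      pselect (inner_scales `]0, +oo[%classic (S `\` null_origin X) lam);
    last by exists 0.
  rewrite /inner_scales/= in_itv/= andbT => -[l0 [t [St t_nonnull] [Slt _]]].
  have Xt := multifractal_nonnull hM hT hX St t_nonnull.
  by have [c Mc] := scaling_factor_ae_cst hM q0 Xq l0 St Slt Xt; exists c.
have [m Mm] := choice factor_cst.
split=> [|ST a a0]; first by exists m.
rewrite {S}ST in hM Mm {factor_cst} *.
have [t [t_neq0 Tt Tat]] := time_set_rescale hT a0.
have Ma : forall s, T s -> {ae P, forall w, M a s w = m a}.
  apply: Mm; split; first by rewrite /= in_itv/= a0.
  exists t; split=> // -[]; first by move/eqP: t_neq0.
  by move/eqP; rewrite mulf_eq0 gt_eqF// (negbTE t_neq0).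
have [_ _ /(_ a)[|_ posM _ fdd]] := hM; first by rewrite /= in_itv/= a0.
exists (m a).
  (* An almost sure positivity statement has a witness since [P] is not zero. *)
  have P_proper : ProperFilter (almost_everywhere P).
    have PT : (0 < P [set: Omega])%E by rewrite probability_setT.
    exact: (ae_properfilter_algebraOfSetsType PT).
  have [w] : exists w : Omega, 0 < m a.
    apply: (@filter_ex _ (almost_everywhere P)).
    by have := Ma t Tt; apply: filterS2 (posM t Tt) => w + <-.
  by [].
apply: fdd_eq_ae fdd => s [Ts _].
- exact: measurable_funM.
- exact: measurable_funM.
- by have := Ma s Ts; apply: filterS => w ->.
Qed.
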